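(* Let $c>0$ and $\lambda=c\,\frac{p\sigma^2}{n}$. Then the function $Q\mapsto R_\lambda(Q\mid X)$ on the set $\mathbb S_p^+$ of $p\times p$ symmetric positive definite matrices is minimized at $Q^*=c\,\Omega$. The optimal risk is $$R_\lambda(Q^*=c\Omega\mid X)=\sigma^2+\frac{\sigma^2}{n}\operatorname{tr}\Big(\Sigma\big(\hat\Sigma+\tfrac{p\sigma^2}{n}\Omega^{-1}\big)^{-1}\Big)=R^{\mathsf{OR}}_{\lambda}(\Omega\mid X)\Big|_{\lambda=\frac{p\sigma^2}{n}}.$$ In particular, if $c=1$, then $R_\lambda(Q\mid X)$ is minimized at $Q^*=\Omega$, and the risk at $\Omega$ equals the oracle risk with $\lambda=\frac{p\sigma^2}{n}$.
   Context: $p,n\ge1$ are fixed, $\sigma^2>0$. Test task: $X\in\mathbb R^{n\times p}$, $X=Z\Sigma^{1/2}$, with $Z$ having i.i.d. entries of mean $0$ and variance $1$ and $\Sigma$ a $p\times p$ positive definite matrix; $y=X\bar\beta+\varepsilon$ with $\mathbb E\bar\beta=0$, $\mathbb E\bar\beta\bar\beta^\top=\frac1p\Omega$ ($\Omega$ positive definite), $\varepsilon$ of mean $0$ and covariance $\sigma^2I_n$, and $X,\bar\beta,\varepsilon$ independent. $\hat\Sigma=\frac1nX^\top X$. For $Q\in\mathbb S_p^+$, $\beta_\lambda(Q)=(X^\top X+n\lambda Q^{-1})^{-1}X^\top y$ and $R_\lambda(Q\mid X)=\mathbb E[(x_{\rm new}^\top\beta_\lambda(Q)-y_{\rm new})^2\mid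 X]$, where $(x_{\rm new},y_{\rm new})$ is an independent test example ($\mathbb Ex_{\rm new}x_{\rm new}^\top=\Sigma$, $y_{\rm new}=x_{\rm new}^\top\bar\beta+\varepsilon_{\rm new}$, $\varepsilon_{\rm new}$ independent with mean $0$, variance $\sigma^2$). Explicitly, $$R_\lambda(Q\mid X)=\sigma^2+\frac{\lambda^2}{p}\operatorname{tr}\big(\Omega Q^{-1}B\Sigma BQ^{-1}\big)-\frac{\lambda\sigma^2}{n}\operatorname{tr}\big(B\Sigma BQ^{-1}\big)+\frac{\sigma^2}{n}\operatorname{tr}(\Sigma B),\qquad B=(\hat\Sigma+\lambda Q^{-1})^{-1}.$$ $R^{\mathsf{OR}}_\lambda(\Omega\mid X)$ denotes $R_\lambda(\Omega\mid X)$, the oracle risk. *)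

(* Defs.v *)
From HB Require Import structures.
From mathcomp Require Import all_boot all_order all_algebra.
From mathcomp Require Import all_classical all_reals all_analysis.
From mathcomp Require Import measurable_realfun.

Set Implicit Arguments.
Unset Strict Implicit.
Unset Printing Implicit Defensive.

Import Order.TTheory GRing.Theory Num.Theory.

Local Open Scope classical_set_scope.
Local Open Scope ring_scope.

Section PositiveDefinite.
Context {R : realType} {p : nat}.
Implicit Types A S : 'M[R]_p.

Definition posdefmx A : Prop :=
  A^T = A /\ forall v : 'cV[R]_p, v != 0 -> 0 < (v^T *m A *m v) 0 0.

(* S is the principal square root of A; it is uniquely determined by A. *)
Definition is_sqrtmx A S : Prop := posdefmx S /\ S *m S = A.

End PositiveDefinite.

Definition minimized_at {R : realType} {U : Type} (D : set U)
  (f : U -> \bar R) (q : U) : Prop :=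
  D q /\ forall q', D q' -> (f q <= f q')%E.

Section Probability.
Context {d : measure_display} {T : measurableType d} {R : realType}.
Variable P : probability T R.

Definition sigma_of {I : Type} (V : I -> T -> R) : set (set T) :=
  <<s \bigcup_i preimage_set_system setT (V i) measurable >>.

Definition mutually_independent {K : finType} (F : K -> set (set T)) : Prop :=
  forall (J : {set K}) (A : K -> set T),
    (forall k, k \in J -> F k (A k)) ->
    P (\bigcap_(k in [set` J]) A k) = (\prod_(k in J) P (A k))%E.

(* g is a version of E[f | G], for f nonnegative and measurable; no
   integrability is needed since both integrals then make sense in [0, +oo]. *)
Definition is_cond_expectation (G : set (set T)) (f : T -> R)
  (g : T -> \bar R) : Prop :=
  (forall B : set (\bar R), measurable B -> G (g @^-1` B)) /\
  (forall A : set T, G A ->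
     (\int[P]_(w in A) g w = \int[P]_(w in A) (f w)%:E)%E).

Definition colRV {k : nat} (V : 'I_k -> {RV P >-> R}) (w : T) : 'cV[R]_k :=
  \col_i V i w.

(* The moment conditions entail square integrability: the expectation of a
   square is +oo when that square is not integrable. *)
Record test_task (n p : nat) (sigma2 : R) (Sigma Omega : 'M[R]_p) :=
  TestTask {
  Z : 'I_n -> 'I_p -> {RV P >-> R} ;
  SigmaHalf : 'M[R]_p ;
  betabar : 'I_p -> {RV P >-> R} ;
  eps : 'I_n -> {RV P >-> R} ;
  xnew : 'I_p -> {RV P >-> R} ;
  epsnew : {RV P >-> R} ;
  design := fun w : T => (\matrix_(i, j) Z i j w) *m SigmaHalf ;
  sigma_design := sigma_of (fun (ij : 'I_n * 'I_p) w => design w ij.1 ij.2) ;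
  Sigma_sqrt : is_sqrtmx Sigma SigmaHalf ;
  Z_indep : mutually_independent
    (fun ij : 'I_n * 'I_p => sigma_of (fun _ : unit => Z ij.1 ij.2)) ;
  Z_ident : forall i j i' j' (B : set R), measurable B ->
    distribution P (Z i j) B = distribution P (Z i' j') B ;
  Z_mean : forall i j, ('E_P[Z i j] = 0)%E ;
  Z_var : forall i j, ('V_P[Z i j] = 1)%E ;
  betabar_mean : forall i, ('E_P[betabar i] = 0)%E ;
  betabar_second_moment : forall i j,
    ('E_P[(betabar i \* betabar j)%R] = (p%:R^-1 * Omega i j)%:E)%E ;
  eps_mean : forall i, ('E_P[eps i] = 0)%E ;
  eps_cov : forall i j,
    (covariance P (eps i) (eps j) = ((sigma2%:M : 'M[R]_n) i j)%:E)%E ;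
  xnew_second_moment : forall i j,
    ('E_P[(xnew i \* xnew j)%R] = (Sigma i j)%:E)%E ;
  epsnew_mean : ('E_P[epsnew] = 0)%E ;
  epsnew_var : ('V_P[epsnew] = sigma2%:E)%E ;
  task_indep : mutually_independent (tnth
    [tuple sigma_design; sigma_of betabar; sigma_of eps; sigma_of xnew;
           sigma_of (fun _ : unit => epsnew)])
}.

End Probability.

Section Ridge.
Context {R : realType} {n p : nat}.
Implicit Types (lambda : R) (Q : 'M[R]_p) (X : 'M[R]_(n, p)).

Definition ridge lambda Q X (y : 'cV[R]_n) : 'cV[R]_p :=
  invmx (X^T *m X + (n%:R * lambda) *: invmx Q) *m X^T *m y.

Definition Sigma_hat X : 'M[R]_p := n%:R^-1 *: (X^T *m X).

Context {d : measure_display} {T : measurableType d} {P : probability T R}.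
Context {sigma2 : R} {Sigma Omega : 'M[R]_p}.
Variable t : test_task P n sigma2 Sigma Omega.

(* Test error at the sample point w, with training design X. *)
Definition sq_error lambda Q X (w : T) : R :=
  let b := colRV (betabar t) w in
  let x := colRV (xnew t) w in
  let y := X *m b + colRV (eps t) w in
  let ynew := (x^T *m b) 0 0 + epsnew t w in
  ((x^T *m ridge lambda Q X y) 0 0 - ynew) ^+ 2.

(* Since the design is independent of everything else, the conditional
   expectation given that the design equals X is the expectation with X held
   fixed. This version is defined for all Q simultaneously. *)
Definition risk lambda Q X : \bar R := ('E_P[sq_error lambda Q X])%E.

Definition oracle_risk lambda X : \bar R := risk lambda Omega X.

End Ridge.

(* Main.v *)
(** With the design X held fixed, independence and the moment conditions reduce
the risk of any linear estimator M y to
  sigma2 + tr (Sigma (p^-1 (M X - 1) Omega (M X - 1)^T + sigma2 M M^T)).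
Completing the square in M, with W = X Omega X^T + p sigma2 1 and
G = (X^T X + p sigma2 Omega^-1)^-1, turns the inner matrix into
p^-1 ((M - G X^T) W (M - G X^T)^T) + sigma2 G, because G X^T W = Omega X^T.
Hence G X^T is optimal among all linear estimators, not only the ridge ones;
it is the ridge estimator with Q = c Omega and lambda = c p sigma2 / n, for
every c.

The risk with X held fixed is a version of the conditional risk because the
joint law of the design and the remaining sources of randomness is a product
measure, to which Tonelli's theorem applies. *)

Require Import Defs.
From HB Require Import structures.
From mathcomp Require Import all_boot all_order all_algebra.
From mathcomp Require Import all_classical all_reals all_analysis.
From mathcomp Require Import measurable_realfun.
From mathcomp Require Import lra ring.
From mathcomp Require Import ring.
Set Implicit Arguments.
Unset Strict Implicit.
Unset Printing Implicit Defensive.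

Import Order.TTheory GRing.Theory Num.Theory.

Local Open Scope classical_set_scope.
Local Open Scope ring_scope.

(** * Optimality among linear estimators *)

Section posdef_algebra.
Context {R : realType}.

Lemma gram_quad_ge0 m k (X : 'M[R]_(m, k)) (v : 'cV[R]_k) :
  0 <= (v^T *m (X^T *m X) *m v) 0 0.
Proof.
rewrite mulmxA -mulmxA -trmx_mul mxE; apply: sumr_ge0 => i _.
by rewrite mxE -expr2 sqr_ge0.
Qed.

Lemma posdefmx_unit p (A : 'M[R]_p) : posdefmx A -> A \in unitmx.
Proof.
move=> [AT Apos]; rewrite -row_free_unit; apply/inj_row_free => v vA0.
apply/eqP/contraT => v0; have := Apos v^T.
by rewrite trmx_eq0 trmxK vA0 mul0mx mxE ltxx => /(_ v0).
Qed.

Lemma posdefmxZ p (a : R) (A : 'M[R]_p) :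
  0 < a -> posdefmx A -> posdefmx (a *: A).
Proof.
move=> a0 [AT Apos]; split=> [|v v0]; first by rewrite linearZ /= AT.
by rewrite -scalemxAr -scalemxAl mxE mulr_gt0 // Apos.
Qed.

(** Substituting [v = A u] turns the quadratic form of the inverse at [v] into that of [A] at
    [u]. *)
Lemma posdefmx_inv p (A : 'M[R]_p) : posdefmx A -> posdefmx (invmx A).
Proof.
move=> pA; have uA := posdefmx_unit pA; case: pA => AT Apos.
have AiT : (invmx A)^T = invmx A by rewrite trmx_inv AT.
split=> // v v0; have := Apos (invmx A *m v).
rewrite trmx_mul AiT mulmxKV // mulmxA; apply.
by apply: contra v0 => /eqP Av0; rewrite -[v](mulKVmx uA) Av0 mulmx0.
Qed.

Lemma posdefmxD_gram m p (X : 'M[R]_(m, p)) (A : 'M[R]_p) :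
  posdefmx A -> posdefmx (X^T *m X + A).
Proof.
move=> [AT Apos]; split=> [|v v0].
  by rewrite linearD /= trmx_mul trmxK AT.
rewrite mulmxDr mulmxDl mxE.
by apply: ltr_wpDl; [exact: gram_quad_ge0 | exact: Apos].
Qed.

Lemma invmxZ_unit p (a : R) (A : 'M[R]_p) :
  a != 0 -> A \in unitmx -> invmx (a *: A) = a^-1 *: invmx A.
Proof.
move=> a0 uA; rewrite invmxZ // unitmxZ ?unitfE //.
Qed.

(** Each diagonal entry of the product is the quadratic form of [W] at a row of [A]. *)
Lemma tr_congr_ge0 m k (A : 'M[R]_(m, k)) (W : 'M[R]_k) :
  (forall v : 'cV[R]_k, 0 <= (v^T *m W *m v) 0 0) -> 0 <= \tr (A *m W *m A^T).
Proof.
move=> Wge0; apply: sumr_ge0 => i _.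
have -> : (A *m W *m A^T) i i = ((row i A)^T^T *m W *m (row i A)^T) 0 0.
  by rewrite trmxK -row_mul !mxE; apply: eq_bigr => j _; rewrite !mxE.
exact: Wge0.
Qed.

End posdef_algebra.

(** * Completing the square in the risk of a linear estimator *)

Section linear_risk.
Context {R : realType} {n p : nat}.
Variables (sigma2 : R) (Sigma Omega : 'M[R]_p) (X : 'M[R]_(n, p)).

(* Expected test error of the linear estimator [M *m y], in excess of the test
   noise [sigma2]. *)
Definition linear_risk (M : 'M[R]_(p, n)) : R :=
  \tr (Sigma *m (p%:R^-1 *: ((M *m X - 1%:M) *m Omega *m (M *m X - 1%:M)^T)
                 + sigma2 *: (M *m M^T))).

Hypotheses (p_gt0 : (0 < p)%N) (sigma2_gt0 : 0 < sigma2).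
Hypothesis Omega_pos : posdefmx Omega.

Let kappa := p%:R * sigma2.
(** For fixed [X], [p^-1 W] is the second moment matrix of the response [y], and [p^-1 Omega X^T] is
    the cross moment of the signal with [y]. *)
Let W := X *m Omega *m X^T + kappa%:M.
Let G := invmx (X^T *m X + kappa *: invmx Omega).

Let kappa_gt0 : 0 < kappa. Proof. by rewrite mulr_gt0 // ltr0n. Qed.

Let Gunit : X^T *m X + kappa *: invmx Omega \in unitmx.
Proof.
by apply/posdefmx_unit/posdefmxD_gram/posdefmxZ => //; exact: posdefmx_inv.
Qed.

Let Omega_sym : Omega^T = Omega. Proof. by case: Omega_pos. Qed.

Let G_sym : G^T = G.
Proof.
have [//] : posdefmx G.
by apply/posdefmx_inv/posdefmxD_gram/posdefmxZ => //; exact: posdefmx_inv.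
Qed.

Let W_sym : W^T = W.
Proof. by rewrite linearD /= !trmx_mul trmxK Omega_sym tr_scalar_mx mulmxA. Qed.

(** Multiplied on the left by the inverse of [G], both sides become [X^T X Omega X^T + kappa X^T].
    This is the normal equation of the best linear prediction of the signal from [y]. *)
Let normal_equation : G *m X^T *m W = Omega *m X^T.
Proof.
have uO := posdefmx_unit Omega_pos.
rewrite -[RHS](mulKmx Gunit) -/G -mulmxA; congr (_ *m _).
rewrite mulmxDl -scalemxAl mulKmx // mulmxDr mul_mx_scalar.
by rewrite !mulmxA.
Qed.

Let quad (M : 'M[R]_(p, n)) := M *m W *m M^T.

Let risk_matrixE M :
  p%:R^-1 *: ((M *m X - 1%:M) *m Omega *m (M *m X - 1%:M)^T)
    + sigma2 *: (M *m M^T) =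
  p%:R^-1 *: (quad (M - G *m X^T) + kappa *: G).
Proof.
have p0 : p%:R != 0 :> R by rewrite pnatr_eq0 -lt0n.
have -> : sigma2 *: (M *m M^T) = p%:R^-1 *: (kappa *: (M *m M^T)).
  by rewrite scalerA /kappa mulrA mulVf // mul1r.
rewrite -scalerDr; congr (_ *: _).
have WN : W *m (G *m X^T)^T = X *m Omega.
  by rewrite -{1}W_sym -trmx_mul normal_equation trmx_mul trmxK Omega_sym.
(* The constant left after completing the square: write [Omega] as [Omega G^-1 G] and expand
   [G^-1]. *)
have CN : Omega *m X^T *m (G *m X^T)^T = Omega - kappa *: G.
  apply/eqP; rewrite eq_sym subr_eq; apply/eqP.
  rewrite trmx_mul trmxK G_sym -{1}(mulmx1 Omega) -(mulmxV Gunit) -/G.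
  rewrite mulmxA mulmxDr mulmxDl !mulmxA; congr (_ + _).
  by rewrite -scalemxAr mulmxV ?posdefmx_unit // -scalemxAl mul1mx.
rewrite /quad [(M - _)^T]raddfB /= !mulmxBl !mulmxBr normal_equation CN.
rewrite -[M *m W *m (G *m X^T)^T]mulmxA WN.
rewrite [M *m W]mulmxDr [(_ + M *m kappa%:M) *m _]mulmxDl.
rewrite mul_mx_scalar -scalemxAl.
have -> : (M *m X - 1%:M)^T = X^T *m M^T - 1%:M.
  by rewrite [LHS]linearB /= trmx_mul trmx1.
rewrite !mulmxBr !mul1mx !mulmx1 !mulmxA.
(* With the products abstracted, the identity is additive and can be checked entrywise. *)
move: (M *m X *m Omega *m X^T *m M^T) (M *m X *m Omega) => A B.
move: (Omega *m X^T *m M^T) (kappa *: (M *m M^T)) (kappa *: G) => C D E.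
by apply/matrixP => i j; rewrite !mxE; ring.
Qed.

Lemma linear_risk_opt :
  linear_risk (G *m X^T) = sigma2 * \tr (Sigma *m G).
Proof.
have p0 : p%:R != 0 :> R by rewrite pnatr_eq0 -lt0n.
rewrite /linear_risk risk_matrixE /quad subrr !mul0mx add0r scalerA.
by rewrite /kappa mulrA mulVf // mul1r -scalemxAr mxtraceZ.
Qed.

(** The excess risk of [M] is [p^-1 tr (Sigma D W D^T)] with [D = M - G X^T]. Cyclicity of the trace
    moves one factor of [Sigma = H H] to the right, which leaves [tr ((H D) W (H D)^T)] with [W]
    positive semidefinite. *)
Lemma linear_risk_min (H : 'M[R]_p) (M : 'M[R]_(p, n)) :
  H^T = H -> H *m H = Sigma -> linear_risk (G *m X^T) <= linear_risk M.
Proof.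
move=> HT HH; rewrite /linear_risk !risk_matrixE.
rewrite -!scalemxAr !mxtraceZ ler_wpM2l ?invr_ge0 ?ler0n //.
rewrite [quad (_ - G *m X^T)]/quad subrr !mul0mx add0r mulmxDr mxtraceD lerDr.
rewrite /quad -HH -[H *m H *m _]mulmxA mxtrace_mulC -[X in \tr (_ *m X)]HT.
move: (M - G *m X^T) => D.
have -> : H *m (D *m W *m D^T) *m H^T = (H *m D) *m W *m (H *m D)^T.
  by rewrite trmx_mul !mulmxA.
apply: tr_congr_ge0 => v; rewrite mulmxDr mulmxDl mxE mul_mx_scalar -scalemxAl.
apply: addr_ge0; last first.
  rewrite mxE mulr_ge0 ?(ltW kappa_gt0) // mxE sumr_ge0 // => i _.
  by rewrite mxE -expr2 sqr_ge0.
have -> : v^T *m (X *m Omega *m X^T) *m v = (X^T *m v)^T *m Omega *m (X^T *m v).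
  by rewrite trmx_mul trmxK !mulmxA.
have [-> | u0] := eqVneq (X^T *m v) 0; first by rewrite mulmx0 mxE.
by apply: ltW; case: Omega_pos => _; exact.
Qed.

End linear_risk.

(** * Independence *)

Section independent_sigma_algebras.
Context {d : measure_display} {T : measurableType d} {R : realType}.
Variable P : probability T R.
Local Open Scope ereal_scope.

Definition independent_classes (E1 E2 : set (set T)) : Prop :=
  forall A B, E1 A -> E2 B -> P (A `&` B) = P A * P B.

Lemma independent_classesC E1 E2 :
  independent_classes E1 E2 -> independent_classes E2 E1.
Proof. by move=> E12 A B E2A E1B; rewrite setIC E12 // muleC. Qed.

Lemma independent_classesS (E1 E2 F1 F2 : set (set T)) :
  F1 `<=` E1 -> F2 `<=` E2 ->
  independent_classes E1 E2 -> independent_classes F1 F2.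
Proof. by move=> F1E1 F2E2 E12 A B /F1E1 E1A /F2E2 E2B; exact: E12. Qed.

(** Dynkin's argument: for fixed [B], the events independent of [B] form a lambda-system, and it
    contains the pi-system [E1]. *)
Lemma independent_sigma_l (E1 E2 : set (set T)) :
  E1 `<=` measurable -> E2 `<=` measurable -> setI_closed E1 ->
  independent_classes E1 E2 -> independent_classes <<s E1>> E2.
Proof.
move=> mE1 mE2 IE1 E12 A B sA E2B; have mB := mE2 _ E2B.
suff: <<s E1>> `<=` [set A | measurable A /\ P (A `&` B) = P A * P B].
  by move=> /(_ _ sA)[].
apply: lambda_system_subset; [by []| | |by []]; last first.
  by move=> C E1C; split; [exact: mE1|exact: E12].
apply/dynkin_lambda_system; split => /=.
- by split; [exact: measurableT|rewrite setTI probability_setT mul1e].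
- move=> C [mC CB]; split; first exact: measurableC.
  have -> : P (~` C `&` B) = P B - P (C `&` B).
    rewrite setIC -setDE setIC; apply: measureD => //.
    by rewrite -ge0_fin_numE ?fin_num_measure.
  rewrite CB probability_setC // muleBl ?mul1e ?fin_num_measure //.
- move=> F tF mF; have mFn n : measurable (F n) by case: (mF n).
  split; first exact: bigcup_measurable.
  rewrite setI_bigcupl !measure_semi_bigcup //.
  + rewrite muleC -(fineK (fin_num_measure P B mB)).
    rewrite -nneseriesZl => [|n _]; last exact: measure_ge0.
    apply: eq_eseriesr => n _; rewrite fineK ?fin_num_measure // muleC.
    by case: (mF n).
  + exact: bigcup_measurable.
  + by move=> n; exact: measurableI.
  + exact: trivIset_setIr.
  + by apply: bigcup_measurable => n _; exact: measurableI.
Qed.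

Lemma sigma_sub_measurable (E : set (set T)) :
  E `<=` measurable -> <<s E>> `<=` measurable.
Proof.
by move=> mE; apply: smallest_sub => //; exact: sigma_algebra_measurable.
Qed.

Lemma independent_sigma (E1 E2 : set (set T)) :
  E1 `<=` measurable -> E2 `<=` measurable ->
  setI_closed E1 -> setI_closed E2 ->
  independent_classes E1 E2 -> independent_classes <<s E1>> <<s E2>>.
Proof.
move=> mE1 mE2 IE1 IE2 E12.
apply: independent_classesC; apply: independent_sigma_l => //.
  exact: sigma_sub_measurable.
by apply: independent_classesC; exact: independent_sigma_l.
Qed.

End independent_sigma_algebras.

(** * Independence of disjoint groups of sigma-algebras *)

Section grouping.
Context {d : measure_display} {T : measurableType d} {R : realType}.
Variable P : probability T R.
Context {K : finType} (F : K -> set (set T)).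
Hypothesis F_sigma : forall k, sigma_algebra setT (F k).
Hypothesis F_meas : forall k, F k `<=` measurable.
Hypothesis F_indep : mutually_independent P F.

(** A union of sigma-algebras need not be closed under intersection; these finite intersections form
    a pi-system that contains the union over [J]. *)
Let rectangles (J : {set K}) : set (set T) :=
  [set A | exists2 B : K -> set T, (forall k, k \in J -> F k (B k)) &
                                   A = \bigcap_(k in [set` J]) B k].

Let F_setT k : F k setT.
Proof.
have [F0 FC _] := F_sigma k.
by rewrite -[setT]setC0 -setTD; exact: FC.
Qed.

Let F_setI k : setI_closed (F k).
Proof.
rewrite -(sigma_algebra_id (F_sigma k)) => A B.
exact: (@measurableI _ (g_sigma_algebraType (F k))).
Qed.

Let rectangles_setI J : setI_closed (rectangles J).
Proof.
move=> _ _ [A FA ->] [B FB ->]; exists (fun k => A k `&` B k).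
  by move=> k kJ; apply: F_setI; [exact: FA|exact: FB].
by rewrite bigcapI.
Qed.

Let rectangles_meas J : rectangles J `<=` measurable.
Proof.
move=> _ [A FA ->]; apply: fin_bigcap_measurable => // k kJ.
exact/F_meas/FA.
Qed.

Let rectangles_indep (J1 J2 : {set K}) :
  (forall k, k \in J1 -> k \notin J2) ->
  independent_classes P (rectangles J1) (rectangles J2).
Proof.
move=> J12 _ _ [A FA ->] [B FB ->].
(* Two rectangles over disjoint index sets intersect in one rectangle over the union, to which
   mutual independence applies. *)
have -> : \bigcap_(k in [set` J1]) A k `&` \bigcap_(k in [set` J2]) B k =
          \bigcap_(k in [set` J1 :|: J2]) (if k \in J1 then A k else B k).
  apply/seteqP; split=> [w [Aw Bw] k /=|w ABw].
    by rewrite inE; case: ifPn => [kJ1 _|_ /= kJ2]; [exact: Aw|exact: Bw].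
  split=> k kJ; have := ABw k; rewrite /= inE.
    by rewrite (_ : k \in J1) // => /(_ isT).
  by rewrite kJ orbT; case: ifPn => [/J12/negP|_]; [|exact].
rewrite !F_indep //; last first.
  by move=> k; rewrite inE; case: ifPn => [kJ1 _|_ /= kJ2]; [exact: FA|exact: FB].
rewrite (bigID (mem J1)) /=; congr (_ * _)%E; apply: eq_big => k /=.
- by rewrite inE; case: (k \in J1); rewrite ?andbF.
- by move=> /andP[_ ->].
- by rewrite inE; case: (boolP (k \in J1)) => [/J12/negbTE ->|]; rewrite ?andbT.
- by move=> /andP[_ /negbTE ->].
Qed.

Lemma independent_grouping (J1 J2 : {set K}) :
  (forall k, k \in J1 -> k \notin J2) ->
  independent_classes P <<s \bigcup_(k in [set` J1]) F k>>
                        <<s \bigcup_(k in [set` J2]) F k>>.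
Proof.
move=> J12; have sub (J : {set K}) :
  <<s \bigcup_(k in [set` J]) F k>> `<=` <<s rectangles J>>.
  apply: sub_sigma_algebra2 => A [k /= kJ FkA].
  (* A member of a single [F k] is a rectangle whose other sides are the full space. *)
  exists (fun j => if j == k then A else setT).
    by move=> j _; case: eqP => [->|].
  apply/seteqP; split=> [w Aw j _ /=|w]; first by case: eqP.
  by move=> /(_ k kJ) /=; rewrite eqxx.
apply: (independent_classesS (sub J1) (sub J2)).
by apply: independent_sigma => //; exact: rectangles_indep.
Qed.

End grouping.

(** * Fubini and Tonelli for a pair of independent maps *)

Section independent_maps.
Context {d d1 d2 : measure_display} {T : measurableType d}
  {T1 : measurableType d1} {T2 : measurableType d2} {R : realType}.
Variable P : probability T R.
Variables (f : {mfun T >-> T1}) (g : {mfun T >-> T2}).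
Hypothesis fg_indep : forall A B, measurable A -> measurable B ->
  (P (f @^-1` A `&` g @^-1` B) = P (f @^-1` A) * P (g @^-1` B))%E.
Local Open Scope ereal_scope.

Let fg (w : T) : T1 * T2 := (f w, g w).

Let fg_meas : measurable_fun setT fg.
Proof. exact: measurable_fun_pair. Qed.

Let fg_mixin := isMeasurableFun.Build _ _ _ _ fg fg_meas.
Let fg_mfun : {mfun T >-> (T1 * T2)%type} := HB.pack fg fg_mixin.

(** A product measure is determined by its values on measurable rectangles, where the equality is
    exactly [fg_indep]. *)
Let joint_lawE (A : set (T1 * T2)) : measurable A ->
  (distribution P f \x distribution P g) A = distribution P fg_mfun A.
Proof. by apply: product_measure_unique => B C mB mC; exact: fg_indep. Qed.

Lemma measurable_integral_indep (h : T1 * T2 -> \bar R) :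
  measurable_fun setT h -> (forall z, 0 <= h z) ->
  measurable_fun setT (fun x => \int[P]_w h (x, g w)).
Proof.
move=> mh h0.
have := measurable_fun_fubini_tonelli_F (m2 := distribution P g) h mh h0.
apply: eq_measurable_fun => x _; rewrite /fubini_F.
by rewrite ge0_integral_distribution //; exact: measurableT_comp.
Qed.

Lemma integral_indep (h : T1 * T2 -> \bar R) :
  measurable_fun setT h -> (forall z, 0 <= h z) ->
  \int[P]_w h (f w, g w) = \int[P]_w \int[P]_v h (f w, g v).
Proof.
move=> mh h0.
transitivity (\int[distribution P fg_mfun]_z h z).
  by rewrite ge0_integral_distribution.
transitivity (\int[distribution P f \x distribution P g]_z h z).
  by apply: eq_measure_integral => A mA _; exact/esym/joint_lawE.
rewrite fubini_tonelli1 // ge0_integral_distribution; last 2 first.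
- exact: measurable_fun_fubini_tonelli_F.
- by move=> x; exact: integral_ge0.
apply: eq_integral => w _; rewrite /= /fubini_F.
by rewrite ge0_integral_distribution //; exact: measurableT_comp.
Qed.

(** Fubini requires integrability under the product law. It follows from integrability of the
    composite under [P], by the Tonelli form applied to the absolute value of [h]. *)
Lemma integral_indep_integrable (h : T1 * T2 -> \bar R) :
  measurable_fun setT h -> P.-integrable setT (fun w => h (f w, g w)) ->
  \int[P]_w h (f w, g w) =
  \int[distribution P f]_x \int[distribution P g]_y h (x, y).
Proof.
move=> mh ih.
transitivity (\int[distribution P fg_mfun]_z h z).
  by rewrite integral_distribution.
transitivity (\int[distribution P f \x distribution P g]_z h z).
  by apply: eq_measure_integral => A mA _; exact/esym/joint_lawE.
rewrite -integral12_prod_meas1 //; apply/integrable12ltyP => //.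
have mah : measurable_fun setT (abse \o h) by exact: measurableT_comp.
suff -> : \int[distribution P f]_x \int[distribution P g]_y `|h (x, y)| =
          \int[P]_w `|h (f w, g w)| by case/integrableP : ih.
rewrite (integral_indep mah) => [|z]; last exact: abse_ge0.
rewrite ge0_integral_distribution; last 2 first.
- exact: measurable_fun_fubini_tonelli_F mah (fun z => abse_ge0 _).
- by move=> x; exact: integral_ge0.
apply: eq_integral => w _; rewrite /= ge0_integral_distribution //.
by apply: (measurableT_comp mah); exact: measurable_pair1.
Qed.

End independent_maps.

Section product_expectation.
Context {d : measure_display} {T : measurableType d} {R : realType}.
Variable P : probability T R.
Variables (X Y : {RV P >-> R}).
Hypothesis XY_indep : forall A B, measurable A -> measurable B ->
  (P (X @^-1` A `&` Y @^-1` B) = P (X @^-1` A) * P (Y @^-1` B))%E.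
Hypotheses (X_int : P.-integrable setT (EFin \o X)).
Hypotheses (Y_int : P.-integrable setT (EFin \o Y)).
Local Open Scope ereal_scope.

(** Taking absolute values for [u] and [v] shows that the product has a finite absolute moment,
    before any signed integral is split. *)
Let ge0_expectation_prod (u v : R -> R) :
  measurable_fun setT u -> measurable_fun setT v ->
  (forall x, 0 <= u x)%R -> (forall x, 0 <= v x)%R ->
  \int[P]_w (u (X w) * v (Y w))%:E =
  (\int[P]_w (u (X w))%:E) * \int[P]_w (v (Y w))%:E.
Proof.
move=> mu mv u0 v0.
rewrite (integral_indep XY_indep
  (h := fun z => (u z.1 * v z.2)%:E)); last 2 first.
- apply/measurable_EFinP; apply: measurable_funM; exact: measurableT_comp.
- by move=> z; rewrite lee_fin mulr_ge0.
have mvY : measurable_fun setT (fun w => (v (Y w))%:E).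
  by apply/measurable_EFinP; exact: measurableT_comp.
rewrite -ge0_integralZr //; last 3 first.
- by apply/measurable_EFinP; exact: measurableT_comp.
- by move=> w _; rewrite lee_fin.
- by apply: integral_ge0 => w _; rewrite lee_fin.
apply: eq_integral => w _; rewrite -ge0_integralZl //; last by rewrite lee_fin.
by move=> z _; rewrite lee_fin.
Qed.

Lemma integrable_indep_prod :
  P.-integrable setT (EFin \o (X \* Y)%R).
Proof.
apply/integrableP; split.
  by apply/measurable_EFinP; apply: measurable_funM; exact: measurable_funP.
under eq_integral do rewrite /= normrM.
rewrite (ge0_expectation_prod (u := fun x => `|x|%R) (v := fun x => `|x|%R)) //.
move/integrableP : X_int => [_ Xoo]; move/integrableP : Y_int => [_ Yoo].
rewrite lte_mul_pinfty //.
- by apply: integral_ge0 => w _; rewrite lee_fin.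
- by rewrite ge0_fin_numE //; apply: integral_ge0 => w _; rewrite lee_fin.
Qed.

Lemma expectation_indep_prod :
  'E_P[(X \* Y)%R] = 'E_P[X] * 'E_P[Y].
Proof.
have ifin (Z : {RV P >-> R}) : P.-integrable setT (EFin \o Z) ->
    \int[distribution P Z]_x x%:E = 'E_P[Z].
  by move=> iZ; rewrite unlock integral_distribution.
have [EX EY] : 'E_P[X] \is a fin_num /\ 'E_P[Y] \is a fin_num.
  by split; apply: expectation_fin_num; exact/Lfun1_integrable.
have iid (Z : {RV P >-> R}) : P.-integrable setT (EFin \o Z) ->
    (distribution P Z).-integrable setT EFin.
  by move=> iZ; apply: integrable_pushforward.
transitivity (\int[P]_w (X w * Y w)%:E); first by rewrite unlock.
rewrite (integral_indep_integrable XY_indep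
  (h := fun z => (z.1 * z.2)%:E)); last 2 first.
- by apply/measurable_EFinP; exact: measurable_funM.
- exact: integrable_indep_prod.
transitivity (\int[distribution P X]_x (x%:E * 'E_P[Y])).
  apply: eq_integral => x _; under eq_integral do rewrite EFinM.
  by rewrite integralZl //; [rewrite ifin|exact: iid].
by rewrite -(fineK EY) integralZr ?ifin //; exact: iid.
Qed.

End product_expectation.

(** * A calculus of means and second moments *)

Section has_mean.
Context {d : measure_display} {T : measurableType d} {R : realType}.
Variable P : probability T R.

(** Integrability travels with the value because linearity of the expectation requires it; long
    expansions can then be assembled term by term. *)
Definition has_mean (f : T -> R) (v : R) : Prop :=
  P.-integrable setT (EFin \o f) /\ ('E_P[f] = v%:E)%E.

Lemma eq_has_mean (f g : T -> R) (u v : R) :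
  f =1 g -> u = v -> has_mean f u -> has_mean g v.
Proof. by move=> /funext -> ->. Qed.

Lemma has_mean_cst (c : R) : has_mean (fun=> c) c.
Proof.
by split; [exact: finite_measure_integrable_cst|exact: expectation_cst].
Qed.

Lemma has_meanD (f g : T -> R) (u v : R) : has_mean f u -> has_mean g v ->
  has_mean (fun w => f w + g w) (u + v).
Proof.
move=> [fi fE] [gi gE]; split; first exact: (integrableD measurableT fi gi).
by rewrite EFinD -fE -gE -expectationD //; exact/Lfun1_integrable.
Qed.

Lemma has_meanZ (c : R) (f : T -> R) (v : R) : has_mean f v ->
  has_mean (fun w => c * f w) (c * v).
Proof.
move=> [fi fE]; split; first exact: (integrableZl measurableT c fi).
rewrite EFinM -fE -expectationZl; last exact/Lfun1_integrable.
by congr ('E_P[_])%E; apply/funext => w /=; rewrite mulrC.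
Qed.

Lemma has_mean_sum (I : Type) (s : seq I) (f : I -> T -> R) (v : I -> R) :
  (forall i, has_mean (f i) (v i)) ->
  has_mean (fun w => \sum_(i <- s) f i w) (\sum_(i <- s) v i).
Proof.
move=> fv; elim: s => [|i s IH].
  by apply: eq_has_mean (has_mean_cst 0) => [w|]; rewrite big_nil.
by apply: eq_has_mean (has_meanD (fv i) IH) => [w|]; rewrite big_cons.
Qed.

(** The product is dominated by the sum of the squares. *)
Lemma integrable_sqr_mul (X Y : {RV P >-> R}) :
  P.-integrable setT (fun w => (X w ^+ 2)%:E) ->
  P.-integrable setT (fun w => (Y w ^+ 2)%:E) ->
  P.-integrable setT (fun w => (X w * Y w)%:E).
Proof.
move=> X2 Y2; apply: le_integrable (integrableD measurableT X2 Y2) => //.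
  by apply/measurable_EFinP; exact: measurable_funM.
move=> w _; rewrite /= lee_fin normrM [leRHS]ger0_norm ?addr_ge0 ?sqr_ge0 //.
rewrite -[X w ^+ 2]real_normK ?num_real // -[Y w ^+ 2]real_normK ?num_real //.
have := sqr_ge0 (`|X w| - `|Y w|); have := normr_ge0 (X w).
have := normr_ge0 (Y w).
move: `|X w| `|Y w| => a b b0 a0 ab; nra.
Qed.

Lemma integrable_sqr_lin (X : {RV P >-> R}) :
  P.-integrable setT (fun w => (X w ^+ 2)%:E) ->
  P.-integrable setT (EFin \o X).
Proof.
move=> X2.
(* Square integrability gives integrability by pairing [X] with the constant 1. *)
have one2 : P.-integrable setT (fun w => ((cst 1 : {RV P >-> R}) w ^+ 2)%:E).
  under eq_fun do rewrite /= expr1n.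
  exact: finite_measure_integrable_cst.
apply: eq_integrable (integrable_sqr_mul X2 one2) => // w _.
by rewrite /= mulr1.
Qed.

Lemma second_moment_integrable (X : {RV P >-> R}) (v : R) :
  ('E_P[(X \* X)%R] = v%:E)%E -> P.-integrable setT (fun w => (X w ^+ 2)%:E).
Proof.
rewrite unlock /= => EX; apply/integrableP; split.
  by apply/measurable_EFinP; exact: measurable_funX.
under eq_integral do rewrite /= ger0_norm ?sqr_ge0 // expr2.
by rewrite EX ltry.
Qed.

Lemma second_moments_has_mean (I : Type) (X : I -> {RV P >-> R})
    (C : I -> I -> R) :
  (forall i j, 'E_P[(X i \* X j)%R] = (C i j)%:E)%E ->
  (forall i j, has_mean (fun w => X i w * X j w) (C i j)) /\
  forall i, P.-integrable setT (EFin \o X i).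
Proof.
move=> XC; have X2 i := second_moment_integrable (XC i i).
split=> [i j|i]; last exact: integrable_sqr_lin.
by split; [exact: integrable_sqr_mul|exact: XC].
Qed.

Lemma expectation_has_mean (X : {RV P >-> R}) :
  P.-integrable setT (EFin \o X) -> has_mean X (fine 'E_P[X]%E).
Proof.
move=> iX; split=> //.
by rewrite fineK //; apply: expectation_fin_num; exact/Lfun1_integrable.
Qed.

Lemma covariance_centered (X Y : {RV P >-> R}) :
  ('E_P[X] = 0)%E -> ('E_P[Y] = 0)%E ->
  (covariance P X Y = 'E_P[(X \* Y)%R])%E.
Proof.
move=> EX EY; rewrite covariance.unlock EX EY; congr ('E_P[_])%E.
by apply/funext => w; rewrite /= -[LHS]/((X w - 0) * (Y w - 0)) !subr0.
Qed.

End has_mean.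

Section independent_means.
Context {d : measure_display} {T : measurableType d} {R : realType}.
Variable P : probability T R.
Context {G1 G2 : set (set T)}.
Hypothesis G12 : independent_classes P <<s G1>> <<s G2>>.

(** Measurability is asked with respect to the generated sigma-algebras, so that [f] and [g] may be
    compound expressions in several sources of randomness. *)
Lemma has_mean_indep_prod (f g : T -> R) (u v : R) :
  measurable_fun setT (f : g_sigma_algebraType G1 -> R) ->
  measurable_fun setT (g : g_sigma_algebraType G2 -> R) ->
  has_mean P f u -> has_mean P g v -> has_mean P (fun w => f w * g w) (u * v).
Proof.
move=> mf mg [fi fE] [gi gE].
have mf' : measurable_fun setT f by move/measurable_EFinP : (measurable_int _ fi).
have mg' : measurable_fun setT g by move/measurable_EFinP : (measurable_int _ gi).
pose X : {RV P >-> R} := HB.pack f (isMeasurableFun.Build _ _ _ _ f mf').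
pose Y : {RV P >-> R} := HB.pack g (isMeasurableFun.Build _ _ _ _ g mg').
have XY A B : measurable A -> measurable B ->
    (P (X @^-1` A `&` Y @^-1` B) = P (X @^-1` A) * P (Y @^-1` B))%E.
  move=> mA mB; apply: G12.
    by rewrite -[X in <<s _>> X]setTI; exact: mf.
  by rewrite -[X in <<s _>> X]setTI; exact: mg.
split; first exact: (integrable_indep_prod XY fi gi).
by rewrite EFinM -fE -gE; exact: (expectation_indep_prod XY fi gi).
Qed.

End independent_means.

(** * The risk of a linear estimator *)

Section sigma_of_theory.
Context {d : measure_display} {T : measurableType d} {R : realType}.

Lemma sigma_of_measurable {I : Type} (V : I -> T -> R) :
  (forall i, measurable_fun setT (V i)) -> sigma_of V `<=` measurable.
Proof.
move=> mV; apply: sigma_sub_measurable => _ [i _ [B mB <-]].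
exact: mV.
Qed.

Lemma measurable_sigma_of {I : Type} (V : I -> T -> R) (G : set (set T)) i :
  sigma_of V `<=` <<s G>> ->
  measurable_fun setT (V i : g_sigma_algebraType G -> R).
Proof.
move=> VG _ B mB; apply: VG; apply: sub_sigma_algebra.
by exists i => //; exists B.
Qed.

End sigma_of_theory.

(** Separates the deterministic weights from the products of random variables, whose means are
    known. *)
Lemma big_distrlr_weighted {R : comPzRingType} (I J : finType)
    (a f : I -> R) (b g : J -> R) :
  (\sum_i a i * f i) * (\sum_j b j * g j) =
  \sum_i \sum_j a i * b j * (f i * g j).
Proof.
rewrite big_distrlr /=; apply: eq_bigr => i _; apply: eq_bigr => j _.
exact: mulrACA.
Qed.

Lemma measurable_inv {R : realType} :
  measurable_fun setT (fun x : R => x^-1).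
Proof.
(* The square makes the base of the power nonnegative. *)
have -> : (fun x : R => x^-1) = (fun x : R => x * (x ^+ 2) `^ (-1)).
  apply/funext => x; rewrite powR_inv1 ?sqr_ge0 //.
  have [->|x0] := eqVneq x 0; first by rewrite invr0 mul0r.
  by rewrite expr2 invfM mulrA divff // mul1r.
apply: measurable_funM => //.
exact: (measurableT_comp (measurable_powR _)).
Qed.

(** * Measurability of matrix-valued maps, entry by entry *)

Section measurable_mx.
Context {d : measure_display} {S : measurableType d} {R : realType}.

Definition measurable_mx m k (F : S -> 'M[R]_(m, k)) : Prop :=
  forall i j, measurable_fun setT (fun s => F s i j).

Lemma measurable_mx_cst m k (A : 'M[R]_(m, k)) : measurable_mx (fun=> A).
Proof. by move=> i j; exact: measurable_cst. Qed.

Lemma measurable_mxT m k (F : S -> 'M[R]_(m, k)) :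
  measurable_mx F -> measurable_mx (fun s => (F s)^T).
Proof. by move=> mF i j; under eq_fun do rewrite mxE; exact: mF. Qed.

Lemma measurable_mxD m k (F G : S -> 'M[R]_(m, k)) :
  measurable_mx F -> measurable_mx G -> measurable_mx (fun s => F s + G s).
Proof.
by move=> mF mG i j; under eq_fun do rewrite mxE; exact: measurable_funD.
Qed.

Lemma measurable_mxM m k l (F : S -> 'M[R]_(m, k)) (G : S -> 'M[R]_(k, l)) :
  measurable_mx F -> measurable_mx G -> measurable_mx (fun s => F s *m G s).
Proof.
move=> mF mG i j; under eq_fun do rewrite mxE.
by apply: measurable_sum => q; exact: measurable_funM.
Qed.

Lemma measurable_det m (F : S -> 'M[R]_m) :
  measurable_mx F -> measurable_fun setT (fun s => \det (F s)).
Proof.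
move=> mF; apply: measurable_sum => s; apply: measurable_funM => //.
by apply: measurable_prod => i _; exact: mF.
Qed.

(** Cramer's formula: an entry of the inverse is a cofactor divided by the determinant.
    Invertibility at every point selects a single branch of [invmx]. *)
Lemma measurable_mx_inv m (F : S -> 'M[R]_m) :
  (forall s, F s \in unitmx) -> measurable_mx F ->
  measurable_mx (fun s => invmx (F s)).
Proof.
move=> uF mF i j; under eq_fun do rewrite /invmx uF !mxE.
apply: measurable_funM.
  exact: (measurableT_comp measurable_inv (measurable_det mF)).
apply: measurable_funM => //; apply: measurable_det => a b.
by under eq_fun do rewrite !mxE; exact: mF.
Qed.

End measurable_mx.

(** * The test task: moments of the error and the conditional risk *)

Section task.
Context {d : measure_display} {T : measurableType d} {R : realType}.
Context {P : probability T R} {n p : nat} {sigma2 : R}.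
Context {Sigma Omega : 'M[R]_p}.
Variable t : test_task P n sigma2 Sigma Omega.

Let fields : 'I_5 -> set (set T) :=
  tnth [tuple sigma_design t; sigma_of (betabar t); sigma_of (eps t);
              sigma_of (xnew t); sigma_of (fun _ : unit => epsnew t)].

(* The [k]-th sources of randomness with [a <= k < b], in the order of
   [task_indep]: design, signal, noise, test point, test noise. *)
Definition sources (a b : nat) : set (set T) :=
  \bigcup_(k in [set` finset (fun k : 'I_5 => (a <= k < b)%N)]) fields k.

Lemma measurable_design ij : measurable_fun setT (fun w => design t w ij.1 ij.2).
Proof.
under eq_fun do rewrite mxE.
apply: measurable_sum => k; apply: measurable_funM => //.
under eq_fun do rewrite mxE.
exact: measurable_funP.
Qed.

Let fields_sigma k : sigma_algebra setT (fields k).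
Proof.
rewrite /fields (tnth_nth set0).
by case: k => -[|[|[|[|[|]]]]] //= ltk5; exact: smallest_sigma_algebra.
Qed.

Let fields_meas k : fields k `<=` measurable.
Proof.
rewrite /fields (tnth_nth set0).
case: k => -[|[|[|[|[|]]]]] //= ltk5; apply: sigma_of_measurable => //.
exact: measurable_design.
Qed.

Lemma sources_meas a b : <<s sources a b>> `<=` measurable.
Proof. by apply: sigma_sub_measurable => A [k _]; exact: fields_meas. Qed.

Lemma sources_indep a b c :
  independent_classes P <<s sources a b>> <<s sources b c>>.
Proof.
apply: independent_grouping => //; first exact: task_indep.
by move=> k; rewrite !inE => /andP[_ kb]; rewrite leqNgt kb.
Qed.

Lemma sub_sources (k : 'I_5) a b :
  (a <= k < b)%N -> fields k `<=` <<s sources a b>>.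
Proof.
by move=> akb A fA; apply: sub_sigma_algebra; exists k => //=; rewrite inE.
Qed.

Lemma measurable_betabar a b i : (a <= 1 < b)%N ->
  measurable_fun setT (betabar t i : g_sigma_algebraType (sources a b) -> R).
Proof.
move=> h; apply: (measurable_sigma_of (V := fun i => betabar t i) i).
exact: (@sub_sources (@Ordinal 5 1 isT)).
Qed.

Lemma measurable_eps a b i : (a <= 2 < b)%N ->
  measurable_fun setT (eps t i : g_sigma_algebraType (sources a b) -> R).
Proof.
move=> h; apply: (measurable_sigma_of (V := fun i => eps t i) i).
exact: (@sub_sources (@Ordinal 5 2 isT)).
Qed.

Lemma measurable_xnew a b i : (a <= 3 < b)%N ->
  measurable_fun setT (xnew t i : g_sigma_algebraType (sources a b) -> R).
Proof.
move=> h; apply: (measurable_sigma_of (V := fun i => xnew t i) i).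
exact: (@sub_sources (@Ordinal 5 3 isT)).
Qed.

Lemma measurable_epsnew a b : (a <= 4 < b)%N ->
  measurable_fun setT (epsnew t : g_sigma_algebraType (sources a b) -> R).
Proof.
move=> h; apply: (measurable_sigma_of (V := fun _ : unit => epsnew t) tt).
exact: (@sub_sources (@Ordinal 5 4 isT)).
Qed.

Let eps_second_moment i j :
  ('E_P[(eps t i \* eps t j)%R] = ((sigma2%:M : 'M[R]_n) i j)%:E)%E.
Proof. by rewrite -covariance_centered ?eps_cov //; exact: eps_mean. Qed.

Let betabar_centered k : has_mean P (betabar t k) 0.
Proof.
have [_ ib] := second_moments_has_mean (betabar_second_moment t).
by split; [exact: ib|exact: betabar_mean].
Qed.

Let eps_centered k : has_mean P (eps t k) 0.
Proof.
have [_ ie] := second_moments_has_mean eps_second_moment.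
by split; [exact: ie|exact: eps_mean].
Qed.

Section linear_estimator.
Variables (X : 'M[R]_(n, p)) (M : 'M[R]_(p, n)).

Let A := M *m X - 1%:M.

(* The error [beta_hat - beta] of the linear estimator [M *m y]. *)
Let u (i : 'I_p) (w : T) : R :=
  \sum_j A i j * betabar t j w + \sum_k M i k * eps t k w.

(** The second moment matrix of the estimation error [u]. *)
Let U := p%:R^-1 *: (A *m Omega *m A^T) + sigma2 *: (M *m M^T).

Let error (w : T) : R := \sum_i xnew t i w * u i w - epsnew t w.

Let u_has_mean i j : has_mean P (fun w => u i w * u j w) (U i j).
Proof.
have [bb _] := second_moments_has_mean (betabar_second_moment t).
have [ee _] := second_moments_has_mean eps_second_moment.
have be k l : has_mean P (fun w => betabar t k w * eps t l w) 0.
  rewrite -(mulr0 0).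
  apply: (has_mean_indep_prod (@sources_indep 1 2 3))
    (betabar_centered k) (eps_centered l).
    exact: measurable_betabar.
  exact: measurable_eps.
(* The product expands into signal-signal, noise-noise and two mixed double sums. The last one
   exchanges [i] and [j], so that [be] serves both mixed sums, which have mean zero. *)
have H := has_meanD (has_meanD
  (has_mean_sum (index_enum 'I_p) (fun k => has_mean_sum (index_enum 'I_p)
     (fun l => has_meanZ (A i k * A j l) (bb k l))))
  (has_mean_sum (index_enum 'I_n) (fun k => has_mean_sum (index_enum 'I_n)
     (fun l => has_meanZ (M i k * M j l) (ee k l)))))
  (has_meanD
  (has_mean_sum (index_enum 'I_p) (fun k => has_mean_sum (index_enum 'I_n)
     (fun l => has_meanZ (A i k * M j l) (be k l))))
  (has_mean_sum (index_enum 'I_p) (fun k => has_mean_sum (index_enum 'I_n)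
     (fun l => has_meanZ (A j k * M i l) (be k l))))).
apply: eq_has_mean H => [w|].
  by rewrite /u -!big_distrlr_weighted; ring.
have Z (I J : finType) (c : I -> J -> R) : \sum_i \sum_j c i j * 0 = 0.
  by rewrite big1 // => k _; rewrite big1 // => l _; rewrite mulr0.
have -> : U i j = p%:R^-1 * (A *m Omega *m A^T) i j + sigma2 * (M *m M^T) i j.
  by rewrite !mxE.
rewrite !Z !addr0; congr (_ + _).
  rewrite [in RHS]mxE exchange_big mulr_sumr; apply: eq_bigr => l _.
  rewrite !mxE mulr_suml mulr_sumr; apply: eq_bigr => k _; ring.
rewrite [in RHS]mxE mulr_sumr; apply: eq_bigr => k _.
rewrite (bigD1 k) //= big1 => [|l lk]; rewrite !mxE ?eqxx ?mulr1n; first by ring.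
by rewrite eq_sym (negbTE lk) mulr0n mulr0.
Qed.

Let measurable_u a b i : (a <= 1 < b)%N -> (a <= 2 < b)%N ->
  measurable_fun setT (u i : g_sigma_algebraType (sources a b) -> R).
Proof.
move=> h1 h2; apply: measurable_funD; apply: measurable_sum => k;
  apply: measurable_funM => //; [exact: measurable_betabar|exact: measurable_eps].
Qed.

(** Expanding the square, the part quadratic in [xnew] has mean [tr (Sigma U)] by independence of
    [u] and [xnew], the mixed part vanishes because [epsnew] is centered and independent of both,
    and the last part has mean [sigma2]. *)
Lemma error_has_mean :
  has_mean P (fun w => error w ^+ 2)
    (sigma2 + linear_risk sigma2 Sigma Omega X M).
Proof.
have [xx xi] := second_moments_has_mean (xnew_second_moment t).
(* The single variable [epsnew] is treated as a family indexed by [unit]; being centered, its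
   variance is its second moment. *)
have [nn ni] := second_moments_has_mean (fun i j : unit =>
  etrans (esym (covariance_centered (epsnew_mean t) (epsnew_mean t)))
    (epsnew_var t)).
have {ni}n0 : has_mean P (epsnew t) 0.
  by split; [exact: ni tt|exact: epsnew_mean].
have u0 i : has_mean P (u i) (\sum_j A i j * 0 + \sum_k M i k * 0).
  by apply: has_meanD; apply: has_mean_sum => k;
    [exact: has_meanZ (betabar_centered k)|exact: has_meanZ (eps_centered k)].
(* The mean of [xnew] is not prescribed, so this mean stays implicit; it is later multiplied by the
   zero mean of [epsnew]. *)
have xu i : has_mean P (fun w => u i w * xnew t i w) _ :=
  has_mean_indep_prod (@sources_indep 1 3 4) (@measurable_u 1 3 i isT isT)
    (@measurable_xnew 3 4 i isT) (u0 i) (expectation_has_mean (xi i)).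
have xun i : has_mean P (fun w => u i w * xnew t i w * epsnew t w) _ :=
  has_mean_indep_prod (@sources_indep 1 4 5)
    (measurable_funM (@measurable_u 1 4 i isT isT) (@measurable_xnew 1 4 i isT))
    (@measurable_epsnew 4 5 isT) (xu i) n0.
have xxuu i j :
    has_mean P (fun w => u i w * u j w * (xnew t i w * xnew t j w)) _ :=
  has_mean_indep_prod (@sources_indep 1 3 4)
    (measurable_funM (@measurable_u 1 3 i isT isT) (@measurable_u 1 3 j isT isT))
    (measurable_funM (@measurable_xnew 3 4 i isT) (@measurable_xnew 3 4 j isT))
    (u_has_mean i j) (xx i j).
have H := has_meanD
  (has_mean_sum (index_enum 'I_p)
     (fun i => has_mean_sum (index_enum 'I_p) (xxuu i)))
  (has_meanD (has_meanZ (-2) (has_mean_sum (index_enum 'I_p) xun)) (nn tt tt)).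
apply: eq_has_mean H => [w|].
  rewrite /error -mulr_suml.
  have -> : \sum_i xnew t i w * u i w = \sum_i u i w * xnew t i w.
    by apply: eq_bigr => i _; rewrite mulrC.
  by rewrite -big_distrlr_weighted; ring.
rewrite -mulr_suml mulr0 mulr0 add0r addrC; congr (_ + _).
rewrite /linear_risk -/A -/U; apply: eq_bigr => i _; rewrite [RHS]mxE.
apply: eq_bigr => k _; rewrite mulrC; congr (_ * _).
(* The trace contains [U k i] where the expansion gave [U i k]; symmetry of [U] is read off from the
   two expectations it represents. *)
have [_ Eik] := u_has_mean i k; have [_ Eki] := u_has_mean k i.
apply: EFin_inj; rewrite -Eik -Eki; congr ('E_P[_])%E.
by apply/funext => w; rewrite mulrC.
Qed.

End linear_estimator.

(** For fixed [X] the ridge estimator is linear in [y], [M y] say, and its estimation error is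
    [M X - 1] applied to the signal plus [M] applied to the noise. *)
Lemma risk_linear lambda Q X :
  risk t lambda Q X =
  (sigma2 + linear_risk sigma2 Sigma Omega X
     (invmx (X^T *m X + (n%:R * lambda) *: invmx Q) *m X^T))%:E.
Proof.
set M := _ *m X^T; have [_ <-] := error_has_mean X M.
congr ('E_P[_])%E; apply/funext => w.
rewrite /sq_error /ridge -/M; congr (_ ^+ 2).
rewrite opprD addrA; congr (_ - _).
set b := colRV (betabar t) w; set e := colRV (eps t) w; set x := colRV _ _.
have -> : (x^T *m (M *m (X *m b + e))) 0 0 - (x^T *m b) 0 0 =
          (x^T *m ((M *m X - 1%:M) *m b + M *m e)) 0 0.
  by rewrite mulmxBl mul1mx !mulmxDr mulmxN !mulmxA !mxE; ring.
rewrite mxE; apply: eq_bigr => i _; rewrite !mxE; congr (_ * (_ + _)).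
  by apply: eq_bigr => j _; rewrite [b _ _]mxE.
by apply: eq_bigr => k _; rewrite [e _ _]mxE.
Qed.

Lemma sigma_designE : <<s sigma_design t>> = sigma_design t.
Proof. by apply: sigma_algebra_id; exact: smallest_sigma_algebra. Qed.

Lemma sigma_design_sub : <<s sigma_design t>> `<=` <<s sources 0 1>>.
Proof. by rewrite sigma_designE; exact: (@sub_sources (@Ordinal 5 0 isT)). Qed.

(** Two copies of the sample space, one carrying the sigma-algebra of the design, the other that of
    the remaining four sources. The identity maps into them are independent, which brings the
    conditional risk under the theorems on independent maps. *)
Let DT := g_sigma_algebraType (sigma_design t).
Let ST := g_sigma_algebraType (sources 1 5).

Let measurable_mx_design : measurable_mx (fun z : DT * ST => design t z.1).
Proof.
move=> i j; apply: (@measurableT_comp _ _ _ _ _ _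
  (fun w : DT => design t w i j) _ fst) => //.
apply: (measurable_sigma_of
  (V := fun (ij : 'I_n * 'I_p) w => design t w ij.1 ij.2) (i, j)).
by rewrite sigma_designE.
Qed.

Let measurable_mx_colRV k (V : 'I_k -> {RV P >-> R}) :
  (forall i, measurable_fun setT (V i : ST -> R)) ->
  measurable_mx (fun z : DT * ST => colRV V z.2).
Proof.
move=> mV i j; under eq_fun do rewrite mxE.
exact: (measurableT_comp (mV i)).
Qed.

(** Joint measurability for Tonelli. Positivity of [l] and [Q] makes the regularized Gram matrix
    invertible for every design. *)
Lemma measurable_sq_error l Q : (0 < n)%N -> 0 < l -> posdefmx Q ->
  measurable_fun setT (fun z : DT * ST => sq_error t l Q (design t z.1) z.2).
Proof.
move=> n0 l0 pQ.
have mx := measurable_mx_colRV (fun i => @measurable_xnew 1 5 i isT).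
have mb := measurable_mx_colRV (fun i => @measurable_betabar 1 5 i isT).
have me := measurable_mx_colRV (fun i => @measurable_eps 1 5 i isT).
have mn : measurable_fun setT (fun z : DT * ST => epsnew t z.2).
  exact: (measurableT_comp (@measurable_epsnew 1 5 isT)).
have mX := measurable_mx_design.
apply: measurable_funX; apply: measurable_funB.
  apply: (measurable_mxM (measurable_mxT mx)); apply: measurable_mxM.
    apply: measurable_mxM (measurable_mxT mX); apply: measurable_mx_inv.
      by move=> z; apply/posdefmx_unit/posdefmxD_gram/posdefmxZ;
        [rewrite mulr_gt0 ?ltr0n|exact: posdefmx_inv].
    apply: measurable_mxD (measurable_mx_cst _).
    exact: (measurable_mxM (measurable_mxT mX)).
  by apply: measurable_mxD me; exact: measurable_mxM.
by apply: measurable_funD mn; exact: (measurable_mxM (measurable_mxT mx)).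
Qed.

Lemma risk_is_cond_expectation l Q : (0 < n)%N -> 0 < l -> posdefmx Q ->
  is_cond_expectation P (sigma_design t)
    (fun w => sq_error t l Q (design t w) w)
    (fun w => risk t l Q (design t w)).
Proof.
move=> n0 l0 pQ; have mh := measurable_sq_error n0 l0 pQ.
have mD : <<s sigma_design t>> `<=` measurable.
  exact: subset_trans sigma_design_sub (@sources_meas 0 1).
have idD : measurable_fun setT (idfun : T -> DT).
  by move=> _ B mB; rewrite setTI; exact: mD.
have idS : measurable_fun setT (idfun : T -> ST).
  by move=> _ B mB; rewrite setTI; exact: sources_meas mB.
pose f : {mfun T >-> DT} :=
  HB.pack (idfun : T -> DT) (isMeasurableFun.Build _ _ _ _ _ idD).
pose g : {mfun T >-> ST} :=
  HB.pack (idfun : T -> ST) (isMeasurableFun.Build _ _ _ _ _ idS).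
have fg A B : measurable A -> measurable B ->
    (P (f @^-1` A `&` g @^-1` B) = P (f @^-1` A) * P (g @^-1` B))%E.
  move=> mA mB; apply: (@sources_indep 0 1 5) => //.
  exact: sigma_design_sub.
split.
- have mr : measurable_fun setT (fun w : DT => risk t l Q (design t w)).
    rewrite /risk expectation.unlock.
    apply: (measurable_integral_indep P g
      (h := fun z : DT * ST => (sq_error t l Q (design t z.1) z.2)%:E)) => [|z].
      exact/measurable_EFinP.
    by rewrite lee_fin sqr_ge0.
  move=> B mB.
  suff : <<s sigma_design t>> ((fun w => risk t l Q (design t w)) @^-1` B).
    by rewrite sigma_designE.
  by rewrite -[X in <<s _>> X]setTI; exact: mr.
- move=> A GA; have mA : measurable (A : set DT) by apply: sub_sigma_algebra.
  (* The indicator of the conditioning event depends on the design coordinate only; absorbed into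
     the integrand, it reduces the claim over [A] to Tonelli over the whole space. *)
  pose h (z : DT * ST) := (\1_A z.1 * sq_error t l Q (design t z.1) z.2)%:E.
  have hE w v : h (w, v) =
      if w \in A then (sq_error t l Q (design t w) v)%:E else 0%E.
    by rewrite /h indicE /=; case: ifP; rewrite ?mul1r ?mul0r.
  have mhA : measurable_fun setT h.
    apply/measurable_EFinP; apply: measurable_funM => //.
    by apply: (measurableT_comp (measurable_indic mA)).
  have h0 z : (0 <= h z)%E by rewrite lee_fin mulr_ge0 ?sqr_ge0.
  rewrite [LHS]integral_mkcond [RHS]integral_mkcond.
  transitivity (\int[P]_w h (f w, g w))%E; last first.
    by apply: eq_integral => w _; rewrite hE patchE.
  rewrite (integral_indep fg mhA h0); apply: eq_integral => w _; rewrite patchE.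
  under [RHS]eq_integral do rewrite hE.
  by case: ifP => _; [rewrite /risk expectation.unlock|rewrite integral0].
Qed.

End task.

Theorem theorem2p5 (R : realType) (d : measure_display) (T : measurableType d)
  (P : probability T R) (n p : nat) (sigma2 : R) (Sigma Omega : 'M[R]_p)
  (t : test_task P n sigma2 Sigma Omega) (c : R) :
  (0 < n)%N -> (0 < p)%N -> 0 < sigma2 ->
  posdefmx Sigma -> posdefmx Omega -> 0 < c ->
  let lambda0 := p%:R * sigma2 / n%:R in
  let lambda := c * lambda0 in
  (* risk l Q (design t w) is the conditional risk E[(error)^2 | X] *)
  (forall (l : R) (Q : 'M[R]_p), 0 < l -> posdefmx Q ->
     is_cond_expectation P (sigma_design t)
       (fun w => sq_error t l Q (design t w) w)
       (fun w => risk t l Q (design t w))) /\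
  (forall w : T,
     let X := design t w in
     [/\ minimized_at posdefmx (fun Q => risk t lambda Q X) (c *: Omega),
         risk t lambda (c *: Omega) X =
           (sigma2 + sigma2 / n%:R *
             \tr (Sigma *m invmx (Sigma_hat X + lambda0 *: invmx Omega)))%:E,
         risk t lambda (c *: Omega) X = oracle_risk t lambda0 X &
         c = 1 ->
           minimized_at posdefmx (fun Q => risk t lambda Q X) Omega /\
           risk t lambda Omega X = oracle_risk t lambda0 X]).
Proof.
move=> n0 p0 s0 pSigma pOmega c0 lambda0 lambda; split=> [l Q l0 pQ|w X].
  exact: risk_is_cond_expectation.
have nR : n%:R != 0 :> R by rewrite pnatr_eq0 -lt0n.
have kappaE : n%:R * lambda0 = p%:R * sigma2 by rewrite /lambda0 mulrC divfK.
have uO := posdefmx_unit pOmega.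
(* Ridge with [lambda] and [c *: Omega], and ridge with [lambda0] and [Omega], are both this linear
   estimator, since [c] cancels in [n lambda c^-1 = n lambda0 = p sigma2]. *)
pose opt := invmx (X^T *m X + (p%:R * sigma2) *: invmx Omega) *m X^T.
have riskE : risk t lambda (c *: Omega) X =
    (sigma2 + linear_risk sigma2 Sigma Omega X opt)%:E.
  have kappacE : n%:R * lambda * c^-1 = p%:R * sigma2.
    by rewrite /lambda mulrCA mulrC mulKf ?gt_eqF.
  by rewrite risk_linear invmxZ_unit ?gt_eqF // scalerA kappacE.
have oracleE : oracle_risk t lambda0 X =
    (sigma2 + linear_risk sigma2 Sigma Omega X opt)%:E.
  by rewrite /oracle_risk risk_linear kappaE.
have [[HT _] HH] := Sigma_sqrt t.
have min_cOmega :
    minimized_at posdefmx (fun Q => risk t lambda Q X) (c *: Omega).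
  split=> [|Q pQ]; first exact: posdefmxZ.
  (* Every ridge estimator is linear, so the bound over all linear estimators applies. *)
  by rewrite riskE risk_linear lee_fin lerD2l; exact: linear_risk_min HT HH.
split=> //.
- rewrite riskE linear_risk_opt //; congr (_ + _)%:E.
  have -> : X^T *m X + (p%:R * sigma2) *: invmx Omega =
            n%:R *: (Sigma_hat X + lambda0 *: invmx Omega).
    by rewrite scalerDr !scalerA mulfV // scale1r kappaE.
  rewrite invmxZ_unit //; first by rewrite -scalemxAr mxtraceZ mulrA.
  (* Invertibility is checked after scaling by [n], where the matrix is a Gram matrix plus a
     positive definite one. *)
  rewrite -(unitmxZ _ (a := n%:R)) ?unitfE // scalerDr !scalerA mulfV //.
  rewrite scale1r kappaE.
  apply/posdefmx_unit/posdefmxD_gram/posdefmxZ; last exact: posdefmx_inv.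
  by rewrite mulr_gt0 // ltr0n.
- by rewrite riskE oracleE.
- move=> c1; move: min_cOmega riskE; rewrite c1 scale1r => minO riskO.
  by split=> //; rewrite riskO oracleE.
Qed.
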